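(* Assume all rewards $R_i^{(j)}(t)$ and $R_{mn}^{(jk)}(t)$ lie in $[0,1]$, and let $\mathcal{F}=[M]^N$. Let $\hat{R}_{total}$ be the total reward achieved by the algorithm MABSTA$(\gamma,\alpha)$ over the $T$ data frames. For any $\gamma\in(0,1)$, if $\alpha=\frac{\gamma}{M(N+|\mathcal{E}|M)}$, then $$R_{total}^{max}-\mathbb{E}\{\hat{R}_{total}\}\le (e-1)\,\gamma\, R_{total}^{max}+\frac{M(N+|\mathcal{E}|M)\ln M^N}{\gamma}.$$
   Context: Setting. $N\ge1$, $M\ge1$, $T\ge1$ are integers, $[K]=\{1,\dots,K\}$. $G=(\mathcal{V},\mathcal{E})$ is a directed acyclic graph with vertex set $\mathcal{V}=[N]$ (tasks); $|\mathcal{E}|$ is its number of edges. $[M]$ is the set of devices. An assignment (arm) is a vector $\mathbf{y}=(y_1,\dots,y_N)\in[M]^N$, where $y_i$ is the device executing task $i$; $\mathcal{F}\subseteq[M]^N$ is the set of feasible assignments. The rewards are arbitrary fixed (deterministic) sequences, unknown to the algorithm: for $t\in[T]$, $R_i^{(j)}(t)\in[0,1]$ for $i\in[N]$, $j\in[M]$ (executing task $i$ on device $j$), and $R_{mn}^{(jk)}(t)\in[0,1]$ for $(m,n)\in\mathcal{E}$, $j,k\in[M]$ (transmitting the data of edge $(m,n)$ from device $j$ to device $k$). The best fixed assignment in hindsight has total reward $$R_{total}^{max}=\max_{\mathbf{x}\in\mathcal{F}}\sum_{t=1}^T\Big(\sum_{i=1}^N R_i^{(x_i)}(t)+\sum_{(m,n)\in\mathcal{E}}R_{mn}^{(x_mx_n)}(t)\Big).$$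 Algorithm MABSTA$(\gamma,\alpha)$. Set $w_{\mathbf{y}}(1)=1$ for all $\mathbf{y}\in\mathcal{F}$. For $t=1,\dots,T$: (1) let $W_t=\sum_{\mathbf{y}\in\mathcal{F}}w_{\mathbf{y}}(t)$ and $p_{\mathbf{y}}(t)=(1-\gamma)\frac{w_{\mathbf{y}}(t)}{W_t}+\frac{\gamma}{|\mathcal{F}|}$; (2) given the past, draw $\mathbf{x}^t\in\mathcal{F}$ from the distribution $(p_{\mathbf{y}}(t))_{\mathbf{y}\in\mathcal{F}}$ and observe the rewards $R_i^{(x_i^t)}(t)$, $i\in[N]$, and $R_{mn}^{(x_m^tx_n^t)}(t)$, $(m,n)\in\mathcal{E}$; (3) let $\mathcal{C}_{ex}^i=\{\mathbf{z}\in\mathcal{F}: z_i=x_i^t\}$ and $\mathcal{C}_{tx}^{mn}=\{\mathbf{z}\in\mathcal{F}: z_m=x_m^t,\ z_n=x_n^t\}$, and define $\hat{R}_i^{(j)}(t)=R_i^{(j)}(t)/\sum_{\mathbf{z}\in\mathcal{C}_{ex}^i}p_{\mathbf{z}}(t)$ if $x_i^t=j$ and $0$ otherwise, and $\hat{R}_{mn}^{(jk)}(t)=R_{mn}^{(jk)}(t)/\sum_{\mathbf{z}\in\mathcal{C}_{tx}^{mn}}p_{\mathbf{z}}(t)$ if $x_m^t=j$ and $x_n^t=k$, and $0$ otherwise; (4) for all $\mathbf{y}\in\mathcal{F}$ set $\hat{R}_{\mathbf{y}}(t)=\sum_{i=1}^N\hat{R}_i^{(y_i)}(t)+\sum_{(m,n)\in\mathcal{E}}\hat{R}_{mn}^{(y_my_n)}(t)$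 and $w_{\mathbf{y}}(t+1)=w_{\mathbf{y}}(t)\exp(\alpha\hat{R}_{\mathbf{y}}(t))$. The total reward achieved is $\hat{R}_{total}=\sum_{t=1}^T\big(\sum_{i=1}^N R_i^{(x_i^t)}(t)+\sum_{(m,n)\in\mathcal{E}}R_{mn}^{(x_m^tx_n^t)}(t)\big)$, and $\mathbb{E}$ is expectation over the algorithm's random draws $\mathbf{x}^1,\dots,\mathbf{x}^T$. *)

(* Defs.v *)
From HB Require Import structures.
From mathcomp Require Export all_boot all_order all_algebra.
From mathcomp Require Export all_classical all_reals all_analysis.
Set Implicit Arguments.
Unset Strict Implicit.
Unset Printing Implicit Defensive.
Export Order.TTheory GRing.Theory Num.Theory.
Export numFieldNormedType.Exports.
Local Open Scope classical_set_scope.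
Local Open Scope ring_scope.

(* Since [cycle e [:: m] = e m m], self-loops are excluded too. *)
Definition acyclic (V : finType) (E : {set V * V}) : Prop :=
  forall c : seq V, cycle (fun m n => (m, n) \in E) c -> c = [::].

Definition assignment (N M : nat) : finType := {ffun 'I_N -> 'I_M}.

(* Frames are numbered from 0: index [t : nat] stands for frame [t + 1] of the
   usual 1-based numbering, and the horizon [T] covers the indices [t < T].
   [Rex t i j] is the reward of executing task [i] on device [j], and
   [Rtx t e j k] that of transmitting the data of edge [e] from [j] to [k]. *)

Definition frame_reward (R : realType) (N M : nat) (E : {set 'I_N * 'I_N})
    (Rex : 'I_N -> 'I_M -> R) (Rtx : 'I_N * 'I_N -> 'I_M -> 'I_M -> R)
    (y : assignment N M) : R :=
  \sum_i Rex i (y i) + \sum_(e in E) Rtx e (y e.1) (y e.2).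

Definition total_reward (R : realType) (N M : nat) (E : {set 'I_N * 'I_N})
    (Rex : nat -> 'I_N -> 'I_M -> R)
    (Rtx : nat -> 'I_N * 'I_N -> 'I_M -> 'I_M -> R)
    (T : nat) (x : nat -> assignment N M) : R :=
  \sum_(t < T) frame_reward E (Rex t) (Rtx t) (x t).

(* The default value 0 of the iterated maximum is harmless when the rewards
   are nonnegative and [F] is nonempty. *)
Definition best_fixed_reward (R : realType) (N M : nat)
    (E : {set 'I_N * 'I_N}) (F : {set assignment N M})
    (Rex : nat -> 'I_N -> 'I_M -> R)
    (Rtx : nat -> 'I_N * 'I_N -> 'I_M -> 'I_M -> R) (T : nat) : R :=
  \big[Num.max/0]_(x in F) total_reward E Rex Rtx T (fun=> x).

(* Sampling distribution on [F] induced by the weights [w]. *)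
Definition mix (R : realType) (N M : nat) (F : {set assignment N M})
    (gamma : R) (w : assignment N M -> R) (y : assignment N M) : R :=
  (1 - gamma) * (w y / \sum_(z in F) w z) + gamma / #|F|%:R.

(* Importance-weighted estimates computed from the draw [x], made with
   sampling distribution [p]. *)
Definition est_ex (R : realType) (N M : nat) (F : {set assignment N M})
    (p : assignment N M -> R) (x : assignment N M)
    (Rex : 'I_N -> 'I_M -> R) (i : 'I_N) (j : 'I_M) : R :=
  if x i == j then Rex i j / \sum_(z in F | z i == x i) p z else 0.

Definition est_tx (R : realType) (N M : nat) (F : {set assignment N M})
    (p : assignment N M -> R) (x : assignment N M)
    (Rtx : 'I_N * 'I_N -> 'I_M -> 'I_M -> R)
    (e : 'I_N * 'I_N) (j k : 'I_M) : R :=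
  if (x e.1 == j) && (x e.2 == k) then
    Rtx e j k / \sum_(z in F | (z e.1 == x e.1) && (z e.2 == x e.2)) p z
  else 0.

(* Weights at frame index [t] along a realization [x] of the draws; they depend
   only on [x s] for [s < t]. Only the values at [y \in F] are meaningful. *)
Fixpoint weight (R : realType) (N M : nat) (E : {set 'I_N * 'I_N})
    (F : {set assignment N M})
    (Rex : nat -> 'I_N -> 'I_M -> R)
    (Rtx : nat -> 'I_N * 'I_N -> 'I_M -> 'I_M -> R)
    (gamma alpha : R) (x : nat -> assignment N M) (t : nat)
    (y : assignment N M) {struct t} : R :=
  match t with
  | 0%N => 1
  | s.+1 =>
    let w := weight E F Rex Rtx gamma alpha x s in
    let p := mix F gamma w in
    w y * expR (alpha * frame_reward E (est_ex F p (x s) (Rex s))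
                                       (est_tx F p (x s) (Rtx s)) y)
  end.

Definition draw_prob (R : realType) (N M : nat) (E : {set 'I_N * 'I_N})
    (F : {set assignment N M})
    (Rex : nat -> 'I_N -> 'I_M -> R)
    (Rtx : nat -> 'I_N * 'I_N -> 'I_M -> 'I_M -> R)
    (gamma alpha : R) (x : nat -> assignment N M) (t : nat) :
    assignment N M -> R :=
  mix F gamma (weight E F Rex Rtx gamma alpha x t).

(* [X] is the random sequence of draws of MABSTA(gamma, alpha) over [T] frames.
   The last clause says that, conditionally on the past draws being
   [x 0, ..., x (t - 1)], the draw [X t] has law [draw_prob ... x t] on [F];
   it is in product form to avoid dividing by a null probability. *)
Record mabsta_run (R : realType) (N M : nat) (E : {set 'I_N * 'I_N})
    (F : {set assignment N M})
    (Rex : nat -> 'I_N -> 'I_M -> R)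
    (Rtx : nat -> 'I_N * 'I_N -> 'I_M -> 'I_M -> R)
    (gamma alpha : R) (T : nat)
    (d : measure_display) (Omega : measurableType d) (P : probability Omega R)
    (X : nat -> Omega -> assignment N M) : Prop := MabstaRun {
  run_measurable : forall t y, (t < T)%N ->
    measurable [set omega | X t omega = y];
  run_feasible : forall t omega, (t < T)%N -> X t omega \in F;
  run_law : forall (t : nat) (x : nat -> assignment N M) (y : assignment N M),
    (t < T)%N -> y \in F ->
    let past := [set omega | forall s, (s < t)%N -> X s omega = x s] in
    P (past `&` [set omega | X t omega = y]) =
      (P past * (draw_prob E F Rex Rtx gamma alpha x t y)%:E)%E
}.

(* Main.v *)
(* The exponential-weights potential W_t gives, along every realization of the
   draws, a bound of the estimated reward of a fixed arm by the reward collected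
   plus second-moment terms sum_y p_y Rhat_y^2; here alpha Rhat_y <= 1 because
   gamma-mixing gives each value of a task (edge) probability at least gamma/M
   (gamma/M^2), and e^x <= 1 + x + (e-2) x^2 on [0, 1].
   A task or an edge is a component c with k_c = M or M^2 values. The
   conditional mean of sum_y p_y Rhat_y^2 is a double sum over components of
   terms T(c, c') <= min(k_c A_c, k_c' A_c'), where A_c is the mean reward of c
   under a uniformly chosen arm. Since 2 T(c, c') <= k_c' A_c + k_c A_c', the
   double sum is at most (sum_c k_c)(sum_c A_c) = M (N + |E| M) sum_c A_c, and
   the uniform means add up over time to at most the best fixed reward. *)
Require Import Defs.
From mathcomp Require Import measurable_realfun ring lra.
Local Open Scope ring_scope.
Set Implicit Arguments.
Unset Strict Implicit.
Unset Printing Implicit Defensive.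

(** * One step of the exponential-weights potential *)

(** In the exponential series from degree two on, each power of [x] is at most [x ^+ 2], and at [1]
    this tail sums to [expR 1 - 2]. *)
Lemma expR_le_quadratic (R : realType) (x : R) :
  0 <= x <= 1 -> expR x <= 1 + x + (expR 1 - 2) * x ^+ 2.
Proof.
move=> /andP[x0 x1].
have partial n (y : R) : series (exp_coeff y) n.+2 =
    1 + y + \sum_(0 <= k < n) y ^+ k.+2 / k.+2`!%:R.
  rewrite /series /= big_nat_recl// big_nat_recl// addrA.
  by rewrite /exp_coeff /= expr0 expr1 fact0 !divr1.
have step n : series (exp_coeff x) n.+2 <= 1 + x + (expR 1 - 2) * x ^+ 2.
  have e1 : series (exp_coeff (1 : R)) n.+2 <= expR 1.
    apply: nondecreasing_cvgn_le; last exact: is_cvg_series_exp_coeff.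
    apply: nondecreasing_series => k _ _; rewrite /exp_coeff /=.
    by rewrite divr_ge0// exprn_ge0.
  rewrite partial lerD2l.
  apply: (@le_trans _ _
    ((\sum_(0 <= k < n) 1 ^+ k.+2 / k.+2`!%:R) * x ^+ 2)); last first.
    rewrite ler_wpM2r ?exprn_ge0//; move: e1; rewrite partial; lra.
  rewrite mulr_suml; apply: ler_sum => k _.
  rewrite expr1n mul1r mulrC ler_wpM2l ?invr_ge0//.
  by rewrite -addn2 exprD ler_piMl ?exprn_ge0// exprn_ile1.
apply: limr_le; first exact: is_cvg_series_exp_coeff.
exists 2%N => // n /= n2; rewrite -(subnK n2) addn2; exact: step.
Qed.

(** The normalized weights are at most [p / (1 - gamma)], so the terms of the quadratic bound may be
    averaged under [p]; then [1 + u <= expR u] applies. *)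
Lemma sum_expR_le (R : realType) (Y : finType) (w p G : Y -> R) (gamma alpha : R) :
  gamma < 1 -> 0 <= alpha ->
  (forall y, 0 <= w y) -> 0 < \sum_z w z ->
  (forall y, (1 - gamma) * (w y / \sum_z w z) <= p y) ->
  (forall y, 0 <= G y) -> (forall y, alpha * G y <= 1) ->
  \sum_y w y * expR (alpha * G y) <=
  (\sum_y w y) * expR ((alpha * (\sum_y p y * G y) +
    (expR 1 - 2) * alpha ^+ 2 * (\sum_y p y * G y ^+ 2)) / (1 - gamma)).
Proof.
move=> g1 a0 w0 W0 wp G0 aG1; set W := \sum_z w z in W0 wp *.
have e2 : 0 <= expR 1 - 2 :> R by rewrite subr_ge0; exact: (expR_ge1Dx 1).
pose L y := alpha * G y + (expR 1 - 2) * alpha ^+ 2 * G y ^+ 2.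
have L0 y : 0 <= L y.
  by rewrite addr_ge0 ?mulr_ge0// ?exprn_ge0.
have g1' : 0 < 1 - gamma by rewrite subr_gt0.
have le_w y : w y <= W * (p y / (1 - gamma)).
  have := wp y; rewrite !mulrA ler_pdivrMr// ler_pdivlMr//.
  by rewrite mulrC [p y * _]mulrC.
apply: (@le_trans _ _ (W * (1 + (\sum_y p y * L y) / (1 - gamma)))).
  rewrite mulrDr mulr1 mulr_suml mulr_sumr -big_split /=.
  apply: ler_sum => y _; apply: (@le_trans _ _ (w y * (1 + L y))).
    rewrite ler_wpM2l//; have := @expR_le_quadratic _ (alpha * G y).
    by rewrite aG1 mulr_ge0// => /(_ isT); rewrite exprMn /L !addrA mulrA.
  by rewrite mulrDr mulr1 lerD2l mulrAC mulrA ler_wpM2r.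
rewrite ler_wpM2l ?(ltW W0)//; apply: (le_trans (expR_ge1Dx _)).
rewrite ler_expR ler_wpM2r ?invr_ge0 ?(ltW g1')// !mulr_sumr -big_split /=.
by apply: ler_sum => y _; rewrite /L mulrDr mulrCA [p y * (_ * _ ^+ 2)]mulrCA.
Qed.

(** * Importance-weighted estimates *)

Section ImportanceWeighting.
Context (R : realFieldType) (Y C : finType) (V : eqType) (Q : pred C).
Context (v : C -> Y -> V) (k : C -> R) (r : C -> Y -> R) (p : Y -> R).

Definition class_prob (c : C) (x : Y) : R := \sum_(z | v c z == v c x) p z.

(** [x] is the drawn arm and [y] the arm being evaluated; [v c] reads off the value of component
    [c], which determines its reward, and [k c] counts these values. *)
Definition iw_est (c : C) (x y : Y) : R :=
  if v c x == v c y then r c y / class_prob c x else 0.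

Hypothesis r_local : forall c y z, v c y = v c z -> r c y = r c z.
Hypothesis r_01 : forall c y, Q c -> 0 <= r c y <= 1.
Hypothesis k_gt0 : forall c, Q c -> 0 < k c.
Hypothesis card_class : forall c y, Q c ->
  #|[pred z | v c z == v c y]|%:R * k c = #|Y|%:R.
Hypothesis p_ge0 : forall y, 0 <= p y.
Hypothesis class_prob_gt0 : forall c y, Q c -> 0 < class_prob c y.

Lemma iw_estE c x y :
  iw_est c x y = (v c x == v c y)%:R * (r c y / class_prob c y).
Proof.
rewrite /iw_est; case: eqP => [e|_]; rewrite ?mul0r// mul1r.
by rewrite /class_prob; under eq_bigl do rewrite e.
Qed.

Lemma sum_class c y : \sum_x p x * (v c x == v c y)%:R = class_prob c y.
Proof.
rewrite /class_prob [RHS]big_mkcond; apply: eq_bigr => x _.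
by rewrite mulr_natr mulrb.
Qed.

Lemma iw_est_ge0 c x y : Q c -> 0 <= iw_est c x y.
Proof.
move=> Qc; rewrite iw_estE mulr_ge0// divr_ge0//; last exact/ltW/class_prob_gt0.
by case/andP: (r_01 y Qc).
Qed.

(** A class has [#|Y| / k c] arms of probability at least [g / #|Y|] each, so the denominator is at
    least [g / k c]. *)
Lemma iw_est_le c x y (g : R) : Q c -> 0 < g ->
  (forall z, g / #|Y|%:R <= p z) -> iw_est c x y <= k c / g.
Proof.
move=> Qc g0 gp; rewrite iw_estE.
have [r0 r1] := andP (r_01 y Qc).
have Y0 : 0 < #|Y|%:R :> R by rewrite ltr0n; apply/card_gt0P; exists y.
have le_g : g / k c <= class_prob c y.
  rewrite /class_prob.
  apply: (le_trans _ (ler_sum _ (fun z _ => gp z))).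
  have -> : \sum_(z | v c z == v c y) g / #|Y|%:R =
      g / #|Y|%:R * #|[pred z | v c z == v c y]|%:R by rewrite sumr_const mulr_natr.
  by rewrite ler_pdivrMr ?k_gt0// -(mulrA (_ / _)) card_class// divfK ?gt_eqF.
have gk : 0 < g / k c by rewrite divr_gt0// k_gt0.
apply: (@le_trans _ _ (1 * (1 / (g / k c)))); last by rewrite mul1r div1r invf_div.
apply: ler_pM => //; rewrite ?divr_ge0 ?(ltW (class_prob_gt0 y Qc))//.
  by rewrite lern1; case: eqP.
by apply: ler_pM; rewrite ?invr_ge0 ?(ltW (class_prob_gt0 y Qc))//
  lef_pV2 ?posrE// class_prob_gt0.
Qed.

Lemma iw_est_unbiased c y : Q c -> \sum_x p x * iw_est c x y = r c y.
Proof.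
move=> Qc; under eq_bigr do rewrite iw_estE mulrA.
by rewrite -mulr_suml sum_class mulrC divfK// gt_eqF ?class_prob_gt0.
Qed.

(** Here the draw is fixed and the evaluated arm is averaged, which recovers the reward actually
    collected. *)
Lemma sum_iw_est_arm c x : Q c -> \sum_y p y * iw_est c x y = r c x.
Proof.
move=> Qc; rewrite -[RHS](@divfK _ (class_prob c x)) ?gt_eqF ?class_prob_gt0//.
rewrite -[X in _ = _ * X]sum_class mulr_sumr; apply: eq_bigr => y _.
rewrite /iw_est eq_sym; case: eqP => [e|_]; rewrite ?(mulr0, mulr1)//.
by rewrite (r_local e) mulrC.
Qed.

(* Every class has [#|Y| / k c] elements, so a sum over all arms is a multiple
   of a sum over the values of [v c]. *)
Lemma sum_reward_over_class c : Q c ->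
  \sum_y p y * (r c y / class_prob c y) = k c * ((\sum_y r c y) / #|Y|%:R).
Proof.
move=> Qc.
have [Y0|/card_gt0P[y0 _]] := posnP #|Y|.
  by rewrite !big_pred0 ?mul0r ?mulr0// => y; have := card0_eq Y0 y; rewrite inE.
have Yneq0 : #|Y|%:R != 0 :> R by rewrite pnatr_eq0 -lt0n; apply/card_gt0P; exists y0.
transitivity (k c / #|Y|%:R * (\sum_y \sum_z
    (v c y == v c z)%:R * (p y * (r c z / class_prob c z)))).
  rewrite mulr_sumr; apply: eq_bigr => y _.
  transitivity (k c / #|Y|%:R * (#|[pred z | v c z == v c y]|%:R *
      (p y * (r c y / class_prob c y)))).
    rewrite [RHS]mulrA [X in _ = X * _]mulrAC (mulrC (k c)) card_class//.
    by rewrite divff// mul1r.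
  congr (_ * _); rewrite -sum1_card natr_sum mulr_suml big_mkcond /=.
  apply: eq_bigr => z _; rewrite inE eq_sym; case: eqP => [e|_]; rewrite ?mul0r//.
  by rewrite (r_local e) /class_prob; under eq_bigl do rewrite e.
rewrite exchange_big /= -mulrA (mulrC _^-1); congr (_ * (_ / _)).
apply: eq_bigr => z _; under eq_bigr do rewrite mulrA (mulrC _%:R).
by rewrite -mulr_suml sum_class mulrC divfK// gt_eqF// class_prob_gt0.
Qed.

(** Dropping the indicator of [c'] and bounding [r c] by 1 leaves [x] only in the indicator of [c],
    whose mean cancels the denominator of [c]. *)
Lemma cross_moment_le c c' : Q c -> Q c' ->
  \sum_x \sum_y p x * p y * (iw_est c x y * iw_est c' x y) <=
  k c' * ((\sum_y r c' y) / #|Y|%:R).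
Proof.
move=> Qc Qc'; rewrite -sum_reward_over_class// exchange_big.
apply: ler_sum => y _.
have [r0 r1] := andP (r_01 y Qc); have [r0' r1'] := andP (r_01 y Qc').
have P0 := class_prob_gt0 y Qc; have P0' := class_prob_gt0 y Qc'.
apply: (@le_trans _ _ (\sum_x p x * (v c x == v c y)%:R *
    ((class_prob c y)^-1 * (p y * (r c' y / class_prob c' y))))); last first.
  by rewrite -mulr_suml sum_class mulVKf ?gt_eqF.
apply: ler_sum => x _; rewrite -!mulrA ler_wpM2l// !mulrA.
rewrite (mulrC _ (p y)) -!mulrA ler_wpM2l// !iw_estE -!mulrA ler_wpM2l//.
rewrite mulrA.
apply: ler_pM; rewrite ?mulr_ge0 ?divr_ge0 ?invr_ge0 ?(ltW P0) ?(ltW P0')//.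
  by rewrite ler_piMl// invr_ge0 ltW.
by rewrite ler_piMl ?divr_ge0 ?(ltW P0')// lern1; case: eqP.
Qed.

(* Cross terms are at most min (k c * A c) (k c' * A c'), with [A c] the uniform
   mean of [r c], hence by AM-GM at most the half-sum of k c' * A c and
   k c * A c'; this is what makes the double sum factor. *)
Lemma second_moment_le :
  \sum_x p x * (\sum_y p y * (\sum_(c | Q c) iw_est c x y) ^+ 2) <=
  (\sum_(c | Q c) k c) * (\sum_(c | Q c) (\sum_y r c y) / #|Y|%:R).
Proof.
pose A c := (\sum_y r c y) / #|Y|%:R.
pose m c c' := \sum_x \sum_y p x * p y * (iw_est c x y * iw_est c' x y).
have mC c c' : m c c' = m c' c.
  by apply: eq_bigr => x _; apply: eq_bigr => y _; congr (_ * _); rewrite mulrC.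
have A0 c : Q c -> 0 <= A c.
  by move=> Qc; rewrite divr_ge0// sumr_ge0// => y _; case/andP: (r_01 y Qc).
have m_le c c' : Q c -> Q c' -> 2 * m c c' <= k c' * A c + k c * A c'.
  move=> Qc Qc'.
  have le1 : m c c' <= k c' * A c' by exact: cross_moment_le.
  have le2 : m c c' <= k c * A c by rewrite mC; exact: cross_moment_le.
  have := A0 _ Qc; have := A0 _ Qc'; have := k_gt0 Qc; have := k_gt0 Qc'.
  have m0 : 0 <= m c c'.
    rewrite !sumr_ge0// => x _; rewrite sumr_ge0// => y _.
    by rewrite !mulr_ge0// iw_est_ge0.
  move=> k0' k0 A0' A0_.
  have sum0 : 0 <= k c' * A c + k c * A c' by rewrite addr_ge0// mulr_ge0// ltW.
  (* Squares are compared: the product of the bounds [k c' * A c'] and [k c * A c] on [m c c'] is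
     also the product of [k c' * A c] and [k c * A c']. *)
  rewrite -(@ler_pXn2r _ 2) ?nnegrE ?mulr_ge0//.
  have : m c c' * m c c' <= k c' * A c' * (k c * A c) by apply: ler_pM.
  have := sqr_ge0 (k c' * A c - k c * A c'); nra.
have -> : \sum_x p x * (\sum_y p y * (\sum_(c | Q c) iw_est c x y) ^+ 2) =
    \sum_(c | Q c) \sum_(c' | Q c') m c c'.
  rewrite /m; under [RHS]eq_bigr do rewrite exchange_big /=.
  rewrite [RHS]exchange_big /=; apply: eq_bigr => x _.
  rewrite mulr_sumr; under [RHS]eq_bigr do rewrite exchange_big /=.
  rewrite [RHS]exchange_big /=; apply: eq_bigr => y _.
  rewrite mulrA expr2 mulr_suml mulr_sumr; apply: eq_bigr => c _.
  by rewrite !mulr_sumr.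
rewrite -(@ler_pM2l _ 2)//.
have -> : 2 * ((\sum_(c | Q c) k c) * (\sum_(c | Q c) A c)) =
    \sum_(c | Q c) \sum_(c' | Q c') (k c' * A c + k c * A c').
  under [RHS]eq_bigr do rewrite big_split /=.
  rewrite big_split /= [X in _ = _ + X]exchange_big /= -big_split /=.
  rewrite mulrA mulr_sumr; apply: eq_bigr => c _.
  by rewrite -mulr_suml -mulrA mulr_natl mulr2n.
rewrite mulr_sumr; apply: ler_sum => c Qc.
by rewrite mulr_sumr; apply: ler_sum => c' Qc'; exact: m_le.
Qed.

End ImportanceWeighting.

(** * Random sequences with given conditional laws *)

Section RandomPath.
Context (R : realType) (Y : finType) (p : (nat -> Y) -> nat -> Y -> R).

Definition agree (n : nat) (x x' : nat -> Y) : Prop :=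
  forall s, (s < n)%N -> x s = x' s.

Definition upd (x : nat -> Y) (t : nat) (y : Y) : nat -> Y :=
  fun s => if s == t then y else x s.

(** Chain rule: [p x s] is the law of draw [s] given the draws of [x] before [s]. *)
Definition path_prob (n : nat) (x : nat -> Y) : R :=
  \prod_(s < n) p x s (x s).

Hypothesis p_past : forall t x x', agree t x x' -> p x t =1 p x' t.
Hypothesis p_ge0 : forall t x y, 0 <= p x t y.
Hypothesis p_sum1 : forall t x, \sum_y p x t y = 1.

Lemma agree_upd x t y : agree t x (upd x t y).
Proof. by move=> s st; rewrite /upd ltn_eqF. Qed.

Lemma agreeW m n x x' : (m <= n)%N -> agree n x x' -> agree m x x'.
Proof. by move=> mn xx' s sm; apply: xx'; apply: leq_trans mn. Qed.

Lemma path_prob_ge0 n x : 0 <= path_prob n x.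
Proof. exact: prodr_ge0. Qed.

Lemma path_prob_agree n x x' : agree n x x' -> path_prob n x = path_prob n x'.
Proof.
move=> xx'; apply: eq_bigr => s _; rewrite xx'//.
by apply: p_past; apply: agreeW xx'; exact: ltnW.
Qed.

Lemma path_prob_upd t x y : path_prob t.+1 (upd x t y) = path_prob t x * p x t y.
Proof.
rewrite /path_prob big_ord_recr /=; congr (_ * _).
  exact/esym/path_prob_agree/agree_upd.
by rewrite /upd eqxx; apply/esym/p_past/agree_upd.
Qed.

(** * Finite paths and their prefixes *)

Context (y0 : Y) (T : nat).

(** Finite paths make expectations finite sums; the filler [y0] from time [T] on only makes them
    total sequences. *)
Definition path_of (h : {ffun 'I_T -> Y}) : nat -> Y :=
  fun s => if insub s is Some i then h i else y0.

Lemma path_of_ord h (i : 'I_T) : path_of h i = h i.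
Proof. by rewrite /path_of valK. Qed.

Definition has_prefix (t : nat) (x : nat -> Y) (h : {ffun 'I_T -> Y}) : bool :=
  [forall i : 'I_T, (i < t)%N ==> (h i == x i)].

Lemma has_prefixP t x h : (t <= T)%N ->
  reflect (agree t (path_of h) x) (has_prefix t x h).
Proof.
move=> tT; apply: (iffP forallP) => [H s st|H i].
  have /eqP <- := implyP (H (Ordinal (leq_trans st tT))) st.
  by rewrite -path_of_ord.
by apply/implyP => it; rewrite -H// path_of_ord.
Qed.

Lemma has_prefix0 x h : has_prefix 0 x h.
Proof. exact/forallP. Qed.

Lemma has_prefix_upd x (i : 'I_T) y h :
  has_prefix i x h && (h i == y) = has_prefix i.+1 (upd x i y) h.
Proof.
apply/andP/forallP => [[/forallP H /eqP hi] j|H].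
  apply/implyP; rewrite ltnS leq_eqVlt /upd => /predU1P[ij|ji].
    by rewrite ij eqxx -hi (val_inj ij).
  by rewrite ltn_eqF//; exact: (implyP (H j)).
split; last by have := implyP (H i) (ltnSn i); rewrite /upd eqxx.
apply/forallP => j; apply/implyP => ji.
by have := implyP (H j) (ltnW ji); rewrite /upd ltn_eqF.
Qed.

Lemma has_prefix_full x h : has_prefix T x h = (h == [ffun i : 'I_T => x i]).
Proof.
apply/forallP/eqP => [H|-> i]; last by rewrite ffunE eqxx implybT.
by apply/ffunP => i; rewrite ffunE; apply/eqP/(implyP (H i)).
Qed.

(** Induction on [T - t]: fixing draw [t] lengthens the prefix by one, and the conditional
    probabilities of that draw sum to 1. *)
Lemma sum_path_prob t x : (t <= T)%N ->
  \sum_(h | has_prefix t x h) path_prob T (path_of h) = path_prob t x.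
Proof.
move=> /subnKC; move: (T - t)%N => n; elim: n t x => [|n IH] t x.
  rewrite addn0 => ->; rewrite (eq_bigl _ _ (has_prefix_full x)) big_pred1_eq.
  apply: path_prob_agree => s sT.
  by rewrite -[s]/(val (Ordinal sT)) path_of_ord ffunE.
move=> tnT; have tT : (t < T)%N by rewrite -tnT addnS ltnS leq_addr.
rewrite (partition_big (fun h : {ffun 'I_T -> Y} => h (Ordinal tT)) predT)//=.
under eq_bigr => y _.
  rewrite (eq_bigl _ _ (has_prefix_upd x (Ordinal tT) y)) /= IH ?addSnnS//.
  by rewrite path_prob_upd over.
by rewrite -mulr_sumr p_sum1 mulr1.
Qed.

Lemma sum_path_prob1 : \sum_h path_prob T (path_of h) = 1.
Proof.
transitivity (path_prob 0 (fun=> y0)); last by rewrite /path_prob big_ord0.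
by rewrite -sum_path_prob//; apply: eq_bigl => h; rewrite has_prefix0.
Qed.

(** * Sums of increments with nonpositive conditional mean *)

Context (D : nat -> (nat -> Y) -> R).
Hypothesis D_adapted : forall t x x', agree t.+1 x x' -> D t x = D t x'.
Hypothesis D_le0 : forall t x, (t < T)%N ->
  \sum_y p x t y * D t (upd x t y) <= 0.

(** Induction on [T - t]: on paths sharing their first [t + 1] draws, [D t] is constant and factors
    out with nonpositive conditional mean; the induction hypothesis handles later increments. *)
Lemma supermartingale_prefix_le0 t x : (t <= T)%N ->
  \sum_(h | has_prefix t x h)
    path_prob T (path_of h) * (\sum_(t <= s < T) D s (path_of h)) <= 0.
Proof.
move=> /subnKC; move: (T - t)%N => n; elim: n t x => [|n IH] t x.
  by rewrite addn0 => ->; rewrite big1// => h _; rewrite big_geq ?mulr0.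
move=> tnT; have tT : (t < T)%N by rewrite -tnT addnS ltnS leq_addr.
rewrite (partition_big (fun h : {ffun 'I_T -> Y} => h (Ordinal tT)) predT)//=.
apply: (@le_trans _ _ (\sum_y path_prob t x * (p x t y * D t (upd x t y)))); last first.
  by rewrite -mulr_sumr mulr_ge0_le0 ?path_prob_ge0 ?D_le0.
apply: ler_sum => y _.
rewrite (eq_bigl _ _ (has_prefix_upd x (Ordinal tT) y)) /=.
under eq_bigr => h pre.
  rewrite big_ltn// mulrDr (@D_adapted t _ (upd x t y)); last exact/has_prefixP.
  over.
rewrite big_split /= -mulr_suml sum_path_prob// path_prob_upd mulrA.
by rewrite gerDl IH// addSnnS.
Qed.

Lemma supermartingale_le0 :
  \sum_h path_prob T (path_of h) * (\sum_(s < T) D s (path_of h)) <= 0.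
Proof.
have := supermartingale_prefix_le0 (fun=> y0) (leq0n T).
under eq_bigl do rewrite has_prefix0.
by under eq_bigr do rewrite big_mkord.
Qed.

(** * Expectations over a random run *)

Context (d : measure_display) (Omega : measurableType d) (P : probability Omega R).
Context (X : nat -> Omega -> Y).
Local Open Scope classical_set_scope.
Definition past (t : nat) (x : nat -> Y) : set Omega :=
  [set omega | agree t (X^~ omega) x].
Hypothesis X_measurable : forall t y, (t < T)%N ->
  measurable [set omega | X t omega = y].
Hypothesis X_law : forall t x y, (t < T)%N ->
  P (past t x `&` [set omega | X t omega = y]) = (P (past t x) * (p x t y)%:E)%E.

Lemma pastS t x : past t.+1 x = past t x `&` [set omega | X t omega = x t].
Proof.
apply/seteqP; split=> omega /=.
  by move=> H; split; [apply: agreeW H | apply: H].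
move=> [H Ht] s; rewrite ltnS leq_eqVlt => /predU1P[->//|]; exact: H.
Qed.

Lemma past0 x : past 0 x = setT.
Proof. by apply/seteqP; split. Qed.

Lemma past_measurable t x : (t <= T)%N -> measurable (past t x).
Proof.
elim: t => [_|t IH tT]; first by rewrite past0.
by rewrite pastS; apply: measurableI; [exact/IH/ltnW|exact: X_measurable].
Qed.

Lemma past_prob t x : (t <= T)%N -> P (past t x) = (path_prob t x)%:E.
Proof.
elim: t => [_|t IH tT]; first by rewrite past0 probability_setT /path_prob big_ord0.
by rewrite pastS X_law// IH 1?ltnW// /path_prob big_ord_recr.
Qed.

(** The events [past T (path_of h)] partition the sample space, so [Phi] along the run is a finite
    combination of their indicators. *)
Lemma expectation_path (Phi : (nat -> Y) -> R) :
  (forall x, 0 <= Phi x) -> (forall x x', agree T x x' -> Phi x = Phi x') ->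
  ('E_P[fun omega => Phi (X^~ omega)] =
    (\sum_h path_prob T (path_of h) * Phi (path_of h))%:E)%E.
Proof.
move=> Phi0 Phi_past; rewrite unlock.
have mpast h : measurable (past T (path_of h)) by exact: past_measurable.
transitivity (\int[P]_omega
    (\sum_h (Phi (path_of h) * \1_(past T (path_of h)) omega)%:E))%E.
  apply: eq_integral => omega _.
  pose h0 : {ffun 'I_T -> Y} := [ffun i : 'I_T => X i omega].
  have h0P h : (omega \in past T (path_of h)) = (h == h0).
    rewrite -[RHS](has_prefix_full (X^~ omega)); apply/idP/idP.
      by rewrite inE => H; apply/has_prefixP => // s sT; rewrite H.
    by move=> /has_prefixP -/(_ (leqnn _)) H; rewrite inE => s sT; rewrite H.
  rewrite sumEFin (bigD1 h0)//= big1; last first.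
    by move=> h /negbTE hh0; rewrite indicE h0P hh0 mulr0.
  rewrite addr0 indicE h0P eqxx mulr1; congr (_%:E); apply: Phi_past.
  by have /set_mem : omega \in past T (path_of h0) by rewrite h0P.
rewrite ge0_integral_sum//; last 2 first.
- move=> h; apply/measurable_EFinP/measurable_funM => //.
- by move=> h omega _; rewrite lee_fin mulr_ge0.
rewrite -sumEFin; apply: eq_bigr => h _.
rewrite (integralZl_indic measurableT (fun=> past T (path_of h)))//; last first.
  by rewrite ltNge Phi0.
rewrite integral_indic// setIT [X in (_ * X)%E](_ : _ = (path_prob T (path_of h))%:E).
  by rewrite -EFinM mulrC.
exact: past_prob.
Qed.

End RandomPath.

(** * Tasks and edges as components *)

(** There is one choice at each position in [S] and [M] elsewhere; the factor [M ^ #|S|] restores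
    [M] choices everywhere. *)
Lemma card_ffun_fix (N M : nat) (S : {set 'I_N}) (y : {ffun 'I_N -> 'I_M}) :
  (#|[pred z : {ffun 'I_N -> 'I_M} | [forall i in S, z i == y i]]| * M ^ #|S| =
   M ^ N)%N.
Proof.
pose F (i : 'I_N) : pred 'I_M := if i \in S then pred1 (y i) else predT.
have -> : #|[pred z : {ffun 'I_N -> 'I_M} | [forall i in S, z i == y i]]| =
    #|(family F : pred {ffun 'I_N -> 'I_M})|.
  apply: eq_card => z; rewrite !inE; apply/forallP/familyP => H i.
    by rewrite /F; have := H i; case: ifP => // _ /=; rewrite inE.
  by have := H i; rewrite /F; case: ifP => //= _; rewrite inE.
rewrite card_family foldrE big_map big_enum /= -prod_nat_const.
rewrite [X in (_ * X)%N]big_mkcond /= -big_split /=.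
under eq_bigr => i _.
  rewrite (_ : (_ * _)%N = M); last first.
    by rewrite /F; case: ifP => _; rewrite ?card1 ?mul1n// muln1 card_ord.
  over.
by rewrite prod_nat_const card_ord.
Qed.

Section Components.
Context (R : realType) (N M : nat) (E : {set 'I_N * 'I_N}).
Context (a : 'I_N -> 'I_M -> R) (b : 'I_N * 'I_N -> 'I_M -> 'I_M -> R).

Definition component : finType := ('I_N + 'I_N * 'I_N)%type.

Definition in_graph (c : component) : bool := if c is inr e then e \in E else true.

(** A task repeats its device so that tasks and edges share one value type. *)
Definition devices (c : component) (y : assignment N M) : 'I_M * 'I_M :=
  match c with inl i => (y i, y i) | inr e => (y e.1, y e.2) end.

Definition component_reward (c : component) (y : assignment N M) : R :=
  match c with inl i => a i (y i) | inr e => b e (y e.1) (y e.2) end.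

Definition num_devices (c : component) : R :=
  if c is inr _ then M%:R * M%:R else M%:R.

Lemma frame_rewardE y :
  frame_reward E a b y = \sum_(c | in_graph c) component_reward c y.
Proof. by rewrite big_sumType. Qed.

Lemma sum_num_devices :
  \sum_(c | in_graph c) num_devices c = M%:R * (N%:R + #|E|%:R * M%:R).
Proof.
rewrite big_sumType /num_devices /= !sumr_const card_ord.
rewrite -[_ *+ N]mulr_natr -[_ *+ #|E|]mulr_natr.
by rewrite mulrDr [in RHS](mulrC #|E|%:R) mulrA.
Qed.

Lemma frame_estimateE p x y :
  frame_reward E (est_ex [set: assignment N M]%SET p x a)
    (est_tx [set: assignment N M]%SET p x b) y =
  \sum_(c | in_graph c) iw_est devices component_reward p c x y.
Proof.
rewrite /frame_reward big_sumType /=; congr (_ + _); apply: eq_bigr => c _.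
  rewrite /est_ex /iw_est /class_prob /= xpair_eqE andbb; case: ifP => // _.
  congr (_ / _); apply: eq_bigl => z; by rewrite finset.in_setT xpair_eqE andbb.
rewrite /est_tx /iw_est /class_prob /= xpair_eqE; case: ifP => // _.
by congr (_ / _); apply: eq_bigl => z; rewrite finset.in_setT xpair_eqE.
Qed.

Lemma component_reward_local c y z :
  devices c y = devices c z -> component_reward c y = component_reward c z.
Proof. by case: c => [i|e] /= []; [move=> ->|move=> -> ->]. Qed.

(** A task fixes one coordinate; an edge fixes two, because its endpoints are distinct. *)
Lemma card_devices_class c (y : assignment N M) :
  (forall e, e \in E -> e.1 != e.2) -> in_graph c ->
  #|[pred z | devices c z == devices c y]|%:R * num_devices c =
  #|assignment N M|%:R.
Proof.
move=> E_irr Qc; rewrite card_ffun !card_ord.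
case: c Qc => [i _|e eE].
  rewrite -(card_ffun_fix [set i]%SET y) cards1 expn1 natrM; congr (_%:R * _).
  apply: eq_card => z; rewrite !inE xpair_eqE andbb.
  apply/idP/forallP => [zy j|/(_ i)]; last by rewrite inE eqxx.
  by apply/implyP; rewrite inE => /eqP ->.
rewrite -(card_ffun_fix [set e.1; e.2]%SET y) cards2 E_irr// natrM natrM.
congr (_%:R * _).
apply: eq_card => z; rewrite !inE xpair_eqE.
apply/andP/forallP => [[zy1 zy2] j|H].
  by apply/implyP; rewrite !inE => /orP[] /eqP ->.
by split; [have := H e.1|have := H e.2]; rewrite !inE eqxx ?orbT.
Qed.

End Components.

(** * Regret analysis *)

Section Mabsta.
Context (R : realType) (N M T : nat) (E : {set 'I_N * 'I_N}).
Context (Rex : nat -> 'I_N -> 'I_M -> R).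
Context (Rtx : nat -> 'I_N * 'I_N -> 'I_M -> 'I_M -> R) (gamma alpha : R).
Let Y : finType := assignment N M.
Let F : {set Y} := [set: Y]%SET.
Let kappa : R := M%:R * (N%:R + #|E|%:R * M%:R).

Hypothesis N_ge1 : (1 <= N)%N.
Hypothesis M_ge1 : (1 <= M)%N.
Hypothesis E_irr : forall e, e \in E -> e.1 != e.2.
Hypothesis Rex_01 : forall t i j, (t < T)%N -> 0 <= Rex t i j <= 1.
Hypothesis Rtx_01 : forall t e j k, (t < T)%N -> e \in E -> 0 <= Rtx t e j k <= 1.
Hypothesis gamma_01 : 0 < gamma < 1.
Hypothesis alphaE : alpha = gamma / kappa.

Definition frame_estimate (t : nat) (p : Y -> R) (x y : Y) : R :=
  frame_reward E (est_ex F p x (Rex t)) (est_tx F p x (Rtx t)) y.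

Lemma kappa_gt0 : 0 < kappa.
Proof.
rewrite mulr_gt0 ?ltr0n//; apply: ltr_wpDr; rewrite ?mulr_ge0// ltr0n//.
Qed.

Lemma card_arms_gt0 : 0 < #|Y|%:R :> R.
Proof. by rewrite card_ffun !card_ord ltr0n expn_gt0 M_ge1. Qed.

Lemma alpha_gt0 : 0 < alpha.
Proof. by rewrite alphaE divr_gt0 ?kappa_gt0//; case/andP: gamma_01. Qed.

Lemma component_reward_01 t c y : (t < T)%N -> in_graph E c ->
  0 <= component_reward (Rex t) (Rtx t) c y <= 1.
Proof. by move=> tT; case: c => [i|e] /= Qc; [exact: Rex_01|exact: Rtx_01]. Qed.

Lemma num_devices_gt0 (c : component N) : 0 < num_devices R M c.
Proof. by case: c => [i|e] /=; rewrite ?mulr_gt0 ?ltr0n. Qed.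

Lemma frame_reward_ge0 t y : (t < T)%N -> 0 <= frame_reward E (Rex t) (Rtx t) y.
Proof.
move=> tT; rewrite frame_rewardE sumr_ge0// => c Qc.
by case/andP: (component_reward_01 y tT Qc).
Qed.

(** * One frame under a law bounded below by uniform exploration *)

Section OneFrame.
Context (t : nat) (p : Y -> R).
Hypothesis tT : (t < T)%N.
Hypothesis p_ge : forall y, gamma / #|Y|%:R <= p y.

Let p_gt0 y : 0 < p y.
Proof.
apply: lt_le_trans (p_ge y); rewrite divr_gt0 ?card_arms_gt0//.
by case/andP: gamma_01.
Qed.

Let P_gt0 c y : in_graph E c -> 0 < class_prob (@devices N M) p c y.
Proof.
move=> _; rewrite /class_prob (bigD1 y)//=; apply: ltr_wpDr => //.
by apply: sumr_ge0 => z _; exact/ltW.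
Qed.

Let r_01 c y (Qc : in_graph E c) := component_reward_01 y tT Qc.

Let card_class c y (Qc : in_graph E c) := @card_devices_class R N M E c y E_irr Qc.

Lemma frame_estimate_ge0 x y : 0 <= frame_estimate t p x y.
Proof.
rewrite /frame_estimate frame_estimateE sumr_ge0// => c Qc.
exact: (iw_est_ge0 r_01).
Qed.

(** Each component contributes at most [num_devices c / gamma], and these counts sum to [kappa]; the
    choice [alpha = gamma / kappa] normalizes the bound to 1. *)
Lemma frame_estimate_le x y : alpha * frame_estimate t p x y <= 1.
Proof.
have [g0 _] := andP gamma_01.
rewrite alphaE mulrAC ler_pdivrMr ?kappa_gt0// mul1r -ler_pdivlMl//.
rewrite /frame_estimate frame_estimateE /kappa -sum_num_devices mulr_sumr.
apply: ler_sum => c Qc; rewrite mulrC.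
by apply: (iw_est_le r_01 _ card_class) => // ? _; exact: num_devices_gt0.
Qed.

Lemma frame_estimate_unbiased y :
  \sum_x p x * frame_estimate t p x y = frame_reward E (Rex t) (Rtx t) y.
Proof.
rewrite frame_rewardE /frame_estimate.
under eq_bigr do rewrite frame_estimateE mulr_sumr.
by rewrite exchange_big /=; apply: eq_bigr => c Qc; exact: (iw_est_unbiased _ P_gt0).
Qed.

Lemma sum_frame_estimate_arm x :
  \sum_y p y * frame_estimate t p x y = frame_reward E (Rex t) (Rtx t) x.
Proof.
rewrite frame_rewardE /frame_estimate.
under eq_bigr do rewrite frame_estimateE mulr_sumr.
rewrite exchange_big /=; apply: eq_bigr => c Qc.
exact: (sum_iw_est_arm (@component_reward_local _ _ _ _ _) P_gt0).
Qed.

Lemma frame_second_moment_le :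
  \sum_x p x * (\sum_y p y * frame_estimate t p x y ^+ 2) <=
  kappa * ((\sum_y frame_reward E (Rex t) (Rtx t) y) / #|Y|%:R).
Proof.
under eq_bigr do under eq_bigr do rewrite /frame_estimate frame_estimateE.
have -> : (\sum_y frame_reward E (Rex t) (Rtx t) y) / #|Y|%:R =
    \sum_(c | in_graph E c)
      (\sum_y component_reward (Rex t) (Rtx t) c y) / #|Y|%:R.
  rewrite -mulr_suml exchange_big; congr (_ / _).
  by apply: eq_bigr => y _; rewrite frame_rewardE.
rewrite /kappa -sum_num_devices.
apply: (second_moment_le (@component_reward_local _ _ _ _ _) r_01 _ card_class).
- by move=> c _; exact: num_devices_gt0.
- by move=> y; exact: ltW.
- by move=> c y; exact: P_gt0.
Qed.

End OneFrame.

(** * Weights, draws and the potential along a realization *)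

Let w := weight E F Rex Rtx gamma alpha.
Let p := draw_prob E F Rex Rtx gamma alpha.

Lemma weight_gt0 x t y : 0 < w x t y.
Proof. by elim: t => [|t IH] //=; rewrite mulr_gt0 ?expR_gt0. Qed.

Lemma weight_agree t x x' : agree t x x' -> w x t = w x' t.
Proof.
elim: t => [//|t IH] xx'; apply/funext => y.
by rewrite /w /= -!/(w _ t) (IH (agreeW (leqnSn t) xx')) (xx' t).
Qed.

Lemma draw_prob_agree t x x' : agree t x x' -> p x t =1 p x' t.
Proof. by move=> xx' y; rewrite /p /draw_prob -!/(w _ t) (weight_agree xx'). Qed.

Lemma sum_weight_gt0 x t : 0 < \sum_y w x t y.
Proof.
have /card_gt0P[y _] : (0 < #|Y|)%N by rewrite -(ltr0n R) card_arms_gt0.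
rewrite (bigD1 y)//= ltr_wpDr ?weight_gt0//.
by apply: sumr_ge0 => z _; exact/ltW/weight_gt0.
Qed.

Lemma draw_probE x t y :
  p x t y = (1 - gamma) * (w x t y / \sum_z w x t z) + gamma / #|Y|%:R.
Proof.
rewrite /p /draw_prob /mix cardsT; congr (_ * (_ / _) + _).
by apply: eq_bigl => z; rewrite finset.in_setT.
Qed.

Lemma draw_prob_ge x t y : gamma / #|Y|%:R <= p x t y.
Proof.
have [_ g1] := andP gamma_01.
rewrite draw_probE lerDr mulr_ge0 ?subr_ge0 ?(ltW g1)// divr_ge0//.
  exact/ltW/weight_gt0.
exact/ltW/sum_weight_gt0.
Qed.

Lemma draw_prob_ge0 t x y : 0 <= p x t y.
Proof.
apply: le_trans (draw_prob_ge x t y); rewrite divr_ge0//.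
by case/andP: gamma_01 => /ltW.
Qed.

Lemma sum_draw_prob t x : \sum_y p x t y = 1.
Proof.
under eq_bigr do rewrite draw_probE.
rewrite big_split /= -mulr_sumr -mulr_suml divff ?gt_eqF ?sum_weight_gt0//.
rewrite sumr_const -(mulr_natr (gamma / _)) divfK ?gt_eqF ?card_arms_gt0//.
by rewrite mulr1 subrK.
Qed.

Let est x t y := frame_estimate t (p x t) (x t) y.

Lemma weightE x n y : w x n y = expR (alpha * \sum_(t < n) est x t y).
Proof.
elim: n => [|n IH]; first by rewrite big_ord0 mulr0 expR0.
by rewrite big_ord_recr /= mulrDr expRD -IH.
Qed.

(** Each step applies [sum_expR_le], the mean estimate under the law of the draw being the reward
    collected. *)
Lemma sum_weight_le x n : (n <= T)%N ->
  \sum_y w x n y <= #|Y|%:R * expR (\sum_(t < n)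
    (alpha * frame_reward E (Rex t) (Rtx t) (x t) +
     (expR 1 - 2) * alpha ^+ 2 * (\sum_y p x t y * est x t y ^+ 2)) / (1 - gamma)).
Proof.
elim: n => [_|n IH nT]; first by rewrite big_ord0 expR0 mulr1 sumr_const.
rewrite big_ord_recr /= expRD mulrA.
apply: le_trans (ler_wpM2r (expR_ge0 _) (IH (ltnW nT))).
rewrite -(sum_frame_estimate_arm n (draw_prob_ge x n)).
have [g0 g1] := andP gamma_01.
apply: sum_expR_le => //; first exact/ltW/alpha_gt0.
- by move=> y; exact/ltW/weight_gt0.
- exact: sum_weight_gt0.
- move=> y; rewrite draw_probE lerDl divr_ge0// ltW//.
- by move=> y; apply: frame_estimate_ge0 => //; exact: draw_prob_ge.
- by move=> y; apply: frame_estimate_le => //; exact: draw_prob_ge.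
Qed.

(** The weight of a single arm is at most the total weight; logarithms are compared and multiplied
    by [1 - gamma]. *)
Lemma path_regret x y :
  (1 - gamma) * (alpha * \sum_(t < T) est x t y) <=
  (1 - gamma) * ln #|Y|%:R +
  \sum_(t < T) (alpha * frame_reward E (Rex t) (Rtx t) (x t) +
     (expR 1 - 2) * alpha ^+ 2 * (\sum_y p x t y * est x t y ^+ 2)).
Proof.
have [g0 g1] := andP gamma_01; have g1' : 0 < 1 - gamma by rewrite subr_gt0.
rewrite -[X in _ <= _ + X](@divfK _ (1 - gamma)) ?gt_eqF// [X in _ <= _ + X]mulrC -mulrDr.
rewrite ler_pM2l// mulr_suml -ler_expR expRD lnK ?posrE ?card_arms_gt0//.
apply: le_trans (sum_weight_le x (leqnn T)).
rewrite -weightE (bigD1 y)//= lerDl sumr_ge0// => z _; exact/ltW/weight_gt0.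
Qed.

(** * Averaging over the draws *)

Definition mean_reward (t : nat) : R :=
  (\sum_y frame_reward E (Rex t) (Rtx t) y) / #|Y|%:R.

(* The random terms of [path_regret], centred at the conditional mean of the
   estimate and at an upper bound of that of the second moment. *)
Definition deviation (y : Y) (t : nat) (x : nat -> Y) : R :=
  (expR 1 - 2) * alpha ^+ 2 *
    ((\sum_z p x t z * est x t z ^+ 2) - kappa * mean_reward t) -
  (1 - gamma) * alpha * (est x t y - frame_reward E (Rex t) (Rtx t) y).

Lemma deviation_adapted y t x x' :
  agree t.+1 x x' -> deviation y t x = deviation y t x'.
Proof.
move=> xx'; have pp : p x t = p x' t.
  by apply/funext/draw_prob_agree/(agreeW (leqnSn t) xx').
by rewrite /deviation /est pp (xx' t).
Qed.

(** Given the past, the estimate of [y] is unbiased, so its centred term averages to 0;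
    [frame_second_moment_le] makes the other term nonpositive. *)
Lemma deviation_le0 y t x : (t < T)%N ->
  \sum_z p x t z * deviation y t (upd x t z) <= 0.
Proof.
move=> tT.
have estE z u : est (upd x t z) t u = frame_estimate t (p x t) z u.
  rewrite /est /upd eqxx; congr frame_estimate; apply/funext => v.
  by apply/esym/draw_prob_agree/agree_upd.
have pE z : p (upd x t z) t = p x t.
  by apply/funext => v; apply/esym/draw_prob_agree/agree_upd.
pose S z := \sum_u p x t u * frame_estimate t (p x t) z u ^+ 2.
pose c2 := (expR 1 - 2) * alpha ^+ 2; pose c1 := (1 - gamma) * alpha.
pose fy := frame_reward E (Rex t) (Rtx t) y.
have -> : \sum_z p x t z * deviation y t (upd x t z) =
    c2 * (\sum_z p x t z * S z - kappa * mean_reward t) -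
    c1 * (\sum_z p x t z * frame_estimate t (p x t) z y - fy).
  (* The constants are multiplied by the total mass 1 of [p x t] to bring everything under one
     sum. *)
  rewrite -[kappa * _]mul1r -[fy]mul1r -(sum_draw_prob t x) !mulr_suml -!sumrB.
  rewrite !mulr_sumr -sumrB; apply: eq_bigr => z _.
  rewrite /deviation estE pE -/c1 -/c2 -/fy.
  under eq_bigr do rewrite estE.
  rewrite -/(S z); ring.
rewrite (frame_estimate_unbiased t (draw_prob_ge x t)) subrr mulr0 subr0.
have e2 : 0 <= expR 1 - 2 :> R by rewrite subr_ge0; exact: (expR_ge1Dx 1).
apply: mulr_ge0_le0; first by rewrite mulr_ge0 ?exprn_ge0// ltW ?alpha_gt0.
rewrite subr_le0.
by apply: frame_second_moment_le => //; exact: draw_prob_ge.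
Qed.

Context (y0 : Y).

Let mean_total : R := \sum_(h : {ffun 'I_T -> Y})
  path_prob p T (path_of y0 h) * total_reward E Rex Rtx T (path_of y0 h).

(** [path_regret] bounds the summed deviations of a path below by a constant minus [alpha] times its
    reward; their mean is nonpositive, and division by [alpha] concludes. *)
Lemma regret_vs_arm y :
  total_reward E Rex Rtx T (fun=> y) - mean_total <=
  gamma * total_reward E Rex Rtx T (fun=> y) +
  (expR 1 - 2) * gamma * (\sum_(t < T) mean_reward t) +
  kappa * ln (M%:R ^+ N) / gamma.
Proof.
have [g0 g1] := andP gamma_01; have a0 := alpha_gt0.
set B := total_reward E Rex Rtx T (fun=> y).
set A := \sum_(t < T) mean_reward t.
pose L : R := ln #|Y|%:R.
have LE : L = ln (M%:R ^+ N) by rewrite /L card_ffun !card_ord natrX.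
have L0 : 0 <= L.
  by rewrite ln_ge0// ler1n -(ltr0n R) card_arms_gt0.
pose pr (h : {ffun 'I_T -> Y}) := path_prob p T (path_of y0 h).
pose total (h : {ffun 'I_T -> Y}) := total_reward E Rex Rtx T (path_of y0 h).
pose cst := (1 - gamma) * alpha * B - (1 - gamma) * L
  - (expR 1 - 2) * alpha ^+ 2 * (kappa * A).
have path_le h :
    cst - alpha * total h <= \sum_(t < T) deviation y t (path_of y0 h).
  rewrite /total; set x := path_of y0 h.
  have -> : \sum_(t < T) deviation y t x =
      (expR 1 - 2) * alpha ^+ 2 *
        (\sum_(t < T) (\sum_z p x t z * est x t z ^+ 2) - kappa * A) -
      (1 - gamma) * alpha * (\sum_(t < T) est x t y - B).
    by rewrite /A /B /total_reward mulr_sumr -!sumrB !mulr_sumr -sumrB.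
  have := path_regret x y.
  rewrite [X in _ <= _ + X](_ : _ = alpha * total_reward E Rex Rtx T x +
    (expR 1 - 2) * alpha ^+ 2 * \sum_(t < T) (\sum_z p x t z * est x t z ^+ 2)).
    by rewrite -/L /cst; lra.
  by rewrite big_split /= /total_reward !mulr_sumr.
have mean_le : cst - alpha * mean_total <= 0.
  apply: le_trans (supermartingale_le0 draw_prob_agree draw_prob_ge0
    sum_draw_prob y0 (@deviation_adapted y) (@deviation_le0 y)).
  have -> : cst - alpha * mean_total = \sum_h pr h * (cst - alpha * total h).
    under eq_bigr do rewrite mulrBr mulrCA.
    rewrite sumrB -mulr_suml -mulr_sumr /pr.
    by rewrite (sum_path_prob1 draw_prob_agree sum_draw_prob) mul1r.
  by apply: ler_sum => h _; rewrite ler_wpM2l// path_prob_ge0//; exact: draw_prob_ge0.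
have k0 := kappa_gt0.
have ak : alpha * kappa = gamma by rewrite alphaE divfK// gt_eqF.
(* After division by [alpha], the identity [alpha * kappa = gamma] turns [alpha ^+ 2 * (kappa * A)]
   into [gamma * A]. *)
have : (1 - gamma) * B - mean_total - (expR 1 - 2) * gamma * A <=
    (1 - gamma) * (L / alpha).
  rewrite -(@ler_pM2l _ alpha)//.
  rewrite [X in _ <= X](_ : _ = (1 - gamma) * L); last by field; rewrite gt_eqF.
  move: mean_le; rewrite /cst -ak; nra.
have : (1 - gamma) * (L / alpha) <= kappa * ln (M%:R ^+ N) / gamma.
  rewrite -LE (_ : kappa * L / gamma = L / alpha); last first.
    by rewrite alphaE; field; rewrite !gt_eqF.
  by rewrite ler_piMl ?divr_ge0 ?(ltW a0)//; lra.
lra.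
Qed.

End Mabsta.

(** * Expected regret against the best fixed arm *)

Theorem theorem1 (R : realType) (N M T : nat)
    (N_ge1 : (1 <= N)%N) (M_ge1 : (1 <= M)%N) (T_ge1 : (1 <= T)%N)
    (E : {set 'I_N * 'I_N}) (E_dag : acyclic E)
    (Rex : nat -> 'I_N -> 'I_M -> R)
    (Rtx : nat -> 'I_N * 'I_N -> 'I_M -> 'I_M -> R)
    (Rex_01 : forall t i j, (t < T)%N -> 0 <= Rex t i j <= 1)
    (Rtx_01 : forall t e j k, (t < T)%N -> e \in E -> 0 <= Rtx t e j k <= 1)
    (gamma alpha : R) (gamma_01 : 0 < gamma < 1)
    (alphaE : alpha = gamma / (M%:R * (N%:R + #|E|%:R * M%:R)))
    (d : measure_display) (Omega : measurableType d) (P : probability Omega R)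
    (X : nat -> Omega -> assignment N M)
    (F : {set assignment N M}) (F_full : F = [set: assignment N M]%SET)
    (run : mabsta_run E F Rex Rtx gamma alpha T P X) :
  let Rmax := best_fixed_reward E F Rex Rtx T in
  let Rtotal := fun omega => total_reward E Rex Rtx T (fun t => X t omega) in
  (Rmax%:E - 'E_P[Rtotal]
    <= ((expR 1 - 1) * gamma * Rmax
        + M%:R * (N%:R + #|E|%:R * M%:R) * ln (M%:R ^+ N) / gamma)%:E)%E.
Proof.
subst F; cbv zeta.
set Rmax := best_fixed_reward _ _ _ _ _; set Rtotal := (X in 'E_P[X]%E).
(* A self-loop would be a cycle of length one. *)
have E_irr e : e \in E -> e.1 != e.2.
  move=> eE; apply/eqP => e12.
  have := @E_dag [:: e.1].
  by rewrite /= andbT {2}e12 -surjective_pairing eE => /(_ isT).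
have arms_gt0 : (0 < #|assignment N M|)%N.
  by rewrite card_ffun !card_ord expn_gt0 M_ge1.
have [y0 _] := card_gt0P arms_gt0.
have reward_ge0 x : 0 <= total_reward E Rex Rtx T x.
  by apply: sumr_ge0 => t _; exact: (frame_reward_ge0 Rex_01 Rtx_01).
pose mean_total : R := \sum_(h : {ffun 'I_T -> assignment N M})
  path_prob (draw_prob E [set: assignment N M]%SET Rex Rtx gamma alpha) T
    (path_of y0 h)
  * total_reward E Rex Rtx T (path_of y0 h).
have -> : 'E_P[Rtotal]%E = mean_total%:E.
  apply: expectation_path => //.
  - by move=> t y tT; exact: run_measurable run _ _ tT.
  - by move=> t x y tT; apply: (run_law run x tT); rewrite finset.in_setT.
  - by move=> x x' xx'; apply: eq_bigr => t _; rewrite xx'.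
rewrite -EFinB lee_fin.
have arm_le y : total_reward E Rex Rtx T (fun=> y) <= Rmax.
  by apply: le_bigmax_cond; rewrite finset.in_setT.
(* The maximum is attained by an arm: arms exist and their totals are at least the default 0. *)
have [ymax RmaxE] : exists y, Rmax = total_reward E Rex Rtx T (fun=> y).
  eexists; apply: (@bigmax_eq_arg _ _ _ 0 y0) => [|y _]; last exact: reward_ge0.
  by rewrite finset.in_setT.
have mean_le : \sum_(t < T) (\sum_y frame_reward E (Rex t) (Rtx t) y)
    / #|assignment N M|%:R <= Rmax.
  rewrite -mulr_suml exchange_big /= ler_pdivrMr ?ltr0n// mulr_natr -sumr_const.
  by apply: ler_sum => y _; exact: arm_le.
have := regret_vs_arm N_ge1 M_ge1 E_irr Rex_01 Rtx_01 gamma_01 alphaE y0 ymax.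
rewrite -RmaxE -/mean_total => regret; apply: (le_trans regret).
have [g0 _] := andP gamma_01.
have e2 : 0 <= (expR 1 - 2) * gamma.
  by rewrite mulr_ge0 ?(ltW g0)// subr_ge0; exact: (expR_ge1Dx 1).
(* The coefficients [gamma] and [(expR 1 - 2) * gamma] of [Rmax] add up to
   [(expR 1 - 1) * gamma]. *)
have := ler_wpM2l e2 mean_le; lra.
Qed.
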